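(* $$\lim_{n\to\infty}\frac{|\mathcal{CS}_{\mathfrak{A}_{\mathcal{P}_n}}|}{|\mathcal{CS}_{\mathfrak{I}_n}|}=1.$$
   Context: A partial Latin square of order $n$ is an $n\times n$ array whose cells are empty or contain a symbol of $[n]$, each symbol at most once per row and column; non-empty means some cell is filled. For $\Theta=(\alpha,\beta,\gamma)\in S_n^3$ (an isotopism), $\Theta$ is an autotopism of $P$ if $\{(\alpha(r),\beta(c),\gamma(s)):(r,c,s)\in O(P)\}=O(P)$, where $O(P)$ is the set of triples (row, column, symbol) of filled cells. The cycle structure of $\Theta$ is the triple of cycle structures (numbers of cycles of each length, fixed points included) of $\alpha,\beta,\gamma$. $\mathcal{CS}_{\mathfrak{I}_n}$ is the set of cycle structures of all elements of $S_n^3$ (so $|\mathcal{CS}_{\mathfrak{I}_n}|=p(n)^3$ with $p$ the partition function), and $\mathcal{CS}_{\mathfrak{A}_{\mathcal{P}_n}}$ is the set of cycle structures of those $\Theta\in S_n^3$ that are autotopisms of at least one non-empty partial Latin square of order $n$. *)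

(* Defs.v *)
From mathcomp Require Import all_boot all_order all_fingroup all_algebra.
From mathcomp Require Import finmap.

Set Implicit Arguments.
Unset Strict Implicit.
Unset Printing Implicit Defensive.

Section PartialLatinSquares.
Variable n : nat.

(* [None] is an empty cell; rows, columns and symbols are numbered 0, ..., n-1. *)
Definition array : finType := 'M[option 'I_n]_n.

Definition partial_latin_square (P : array) : bool :=
  [forall s : 'I_n,
     [forall r : 'I_n, #|[set c : 'I_n | P r c == Some s]| <= 1] &&
     [forall c : 'I_n, #|[set r : 'I_n | P r c == Some s]| <= 1]].

Definition nonempty_array (P : array) : bool :=
  [exists r : 'I_n, exists c : 'I_n, P r c != None].

Definition triple : finType := ('I_n * 'I_n * 'I_n)%type.

Definition entries (P : array) : {set triple} :=
  [set t : triple | let: (r, c, s) := t in P r c == Some s].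

Definition isotopism : finType := ('S_n * 'S_n * 'S_n)%type.

Definition isotopism_act (Theta : isotopism) (t : triple) : triple :=
  let: (alpha, beta, gamma) := Theta in
  let: (r, c, s) := t in (alpha r, beta c, gamma s).

Definition autotopism (Theta : isotopism) (P : array) : bool :=
  [set isotopism_act Theta t | t in entries P] == entries P.

(* The value at l is the number of cycles of length l; it is 0 at l = 0. *)
Definition perm_cycle_structure (s : 'S_n) : {ffun 'I_n.+1 -> nat} :=
  [ffun l : 'I_n.+1 => #|[set C in porbits s | #|C| == l]|].

Definition cycle_structure (Theta : isotopism) :
    {ffun 'I_n.+1 -> nat} * {ffun 'I_n.+1 -> nat} * {ffun 'I_n.+1 -> nat} :=
  let: (alpha, beta, gamma) := Theta in
  (perm_cycle_structure alpha, perm_cycle_structure beta,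
   perm_cycle_structure gamma).

Definition CS_isotopisms :=
  [fset cycle_structure Theta | Theta in [set: isotopism]]%fset.

Definition CS_autotopisms :=
  [fset cycle_structure Theta | Theta in
     [set Theta : isotopism | [exists P : array,
        [&& partial_latin_square P, nonempty_array P & autotopism Theta P]]]]%fset.

End PartialLatinSquares.

(* Main.v *)
(** Rows, columns and symbols fixed by [alpha], [beta], [gamma] give a partial
Latin square with a single filled cell, so it suffices that almost every
partition of [n] has a part 1. Let [Q] be the set of partitions without part 1
and fix [k]. Splitting one part [m] of a member of [Q] into [m] ones is
injective in the partition and [m], so at most [p(n)/k] members of [Q] have [k]
or more distinct part sizes. Those with at most [k] sizes number at most
[(n+1)^(2k)], whereas choosing the multiplicities of [2, ..., 2k+2] freely below
[M ~ n/(2k+3)^2] and filling up with ones gives [p(n) >= M^(2k+1)]. Hence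
[|Q|/p(n) <= 2/k] for large [n]. *)
Require Import Defs.
From mathcomp Require Import all_boot all_order all_fingroup all_algebra.
From mathcomp Require Import finmap zify lra.

Set Implicit Arguments.
Unset Strict Implicit.
Unset Printing Implicit Defensive.

(** * Partitions of [n] as multiplicity functions *)

Section Partitions.
Variable n : nat.
Implicit Types f g : {ffun 'I_n.+1 -> 'I_n.+1}.

(* [f l] is the multiplicity of the part [l]. *)
Definition partitions : {set {ffun 'I_n.+1 -> 'I_n.+1}} :=
  [set f : {ffun _} | (f ord0 == ord0) && (\sum_(l < n.+1) l * f l == n)].

(** For [n = 0] the default of [inord] makes this [ord0], hence the hypothesis [n_gt0] below. *)
Definition one : 'I_n.+1 := inord 1.

Definition onefree : {set {ffun 'I_n.+1 -> 'I_n.+1}} :=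
  [set f : {ffun _} in partitions | f one == ord0].

Definition part_sizes f : {set 'I_n.+1} := [set l | f l != ord0].

(** The value of [F] at [one] is discarded. Truncated subtraction and [inord] make this total; it is
    meaningful when the other parts add up to at most [n]. *)
Definition fill_with_ones (F : 'I_n.+1 -> nat) : {ffun 'I_n.+1 -> 'I_n.+1} :=
  [ffun l => inord (if l == one then n - \sum_(i < n.+1 | i != one) i * F i
                    else F l)].

Hypothesis n_gt0 : 0 < n.

Lemma oneE : one = 1 :> nat.
Proof. by rewrite inordK. Qed.

Lemma ord0_neq1 : ord0 != one.
Proof. by apply/eqP => /(congr1 val); rewrite /= oneE. Qed.

Lemma fill_with_ones_one F :
  fill_with_ones F one = n - \sum_(i < n.+1 | i != one) i * F i :> nat.
Proof. by rewrite ffunE eqxx inordK // ltnS leq_subr. Qed.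

(** [inord] does no harm: for [l > 0], [F l] is at most the summand [l * F l], hence at most [n]. *)
Lemma fill_with_ones_neq F l : F ord0 = 0 ->
  \sum_(i < n.+1 | i != one) i * F i <= n -> l != one ->
  fill_with_ones F l = F l :> nat.
Proof.
move=> F0 leFn l1; rewrite ffunE (negbTE l1) inordK // ltnS.
case: (posnP l) => [l0|l_gt0]; first by rewrite (_ : l = ord0) ?F0 //; apply/val_inj.
apply: leq_trans leFn; rewrite (bigD1 l) //=.
by apply: leq_trans (leq_addr _ _); rewrite leq_pmull.
Qed.

Lemma fill_with_ones_in F : F ord0 = 0 ->
  \sum_(i < n.+1 | i != one) i * F i <= n -> fill_with_ones F \in partitions.
Proof.
move=> F0 leFn; rewrite inE; apply/andP; split.
  by apply/eqP/val_inj; rewrite /= fill_with_ones_neq // ord0_neq1.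
rewrite (bigD1 one) //= fill_with_ones_one oneE mul1n.
under eq_bigr => i i1 do rewrite fill_with_ones_neq //.
by rewrite subnK.
Qed.

Lemma onefree_sum f : f \in onefree -> \sum_(i < n.+1 | i != one) i * f i = n.
Proof.
rewrite !inE => /andP[/andP[_ /eqP sum_f] /eqP f1].
by rewrite -[RHS]sum_f [RHS](bigD1 one) //= f1 muln0.
Qed.

Lemma onefree_size f l : f \in onefree -> l \in part_sizes f ->
  (l != one) && (l != ord0).
Proof.
rewrite !inE => /andP[/andP[/eqP f0 _] /eqP f1].
case: (eqVneq l one) => [->|_]; rewrite ?f1 // => fl.
by apply: contraNneq fl => ->; rewrite f0.
Qed.

(** When [f] has no part 1 and [m] is one of its sizes, the removed weight comes back as exactly [m]
    ones. *)
Definition split_part f (m : 'I_n.+1) := fill_with_ones (fun l => f l - (l == m)).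

Lemma split_part_sum f m : f \in onefree -> m \in part_sizes f ->
  \sum_(i < n.+1 | i != one) i * (f i - (i == m)) = n - m.
Proof.
move=> fQ mf; have /andP[m1 m0] := onefree_size fQ mf.
have := onefree_sum fQ; rewrite (bigD1 m) //= => sum_f.
rewrite (bigD1 m) //= eqxx.
under eq_bigr => i /andP[_ /negbTE im] do rewrite im subn0.
have fm : 0 < f m by move: mf; rewrite inE lt0n; apply: contra.
rewrite mulnBr muln1 addnBAC ?leq_pmulr //.
by congr (_ - _); rewrite -[RHS]sum_f.
Qed.

Lemma split_part_in f m : f \in onefree -> m \in part_sizes f ->
  split_part f m \in partitions.
Proof.
move=> fQ mf; apply: fill_with_ones_in; last by rewrite split_part_sum ?leq_subr.
by move: fQ; rewrite !inE => /andP[/andP[/eqP-> _] _].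
Qed.

Lemma split_part_one f m : f \in onefree -> m \in part_sizes f ->
  split_part f m one = m :> nat.
Proof.
move=> fQ mf; rewrite fill_with_ones_one split_part_sum // subKn //.
by rewrite -ltnS.
Qed.

Lemma split_part_neq f m l : f \in onefree -> m \in part_sizes f -> l != one ->
  split_part f m l + (l == m) = f l :> nat.
Proof.
move=> fQ mf l1; rewrite fill_with_ones_neq ?split_part_sum ?leq_subr //.
  by rewrite subnK //; case: eqP => // ->; move: mf; rewrite inE lt0n; apply: contra.
by move: fQ; rewrite !inE => /andP[/andP[/eqP-> _] _].
Qed.

Lemma sum_card_part_sizes : \sum_(f in onefree) #|part_sizes f| <= #|partitions|.
Proof.
(* The number of ones created recovers the part that was split. *)
under eq_bigr do rewrite -sum1_card.
rewrite pair_big_dep /= sum1_card.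
set D := (X in #|X|).
rewrite -(@card_in_imset _ _ (fun u => split_part u.1 u.2) D); last first.
  move=> [f m] [g p] => /andP[/= fQ mf] /andP[/= gQ pg] eq_fg.
  have eq_mp : m = p.
    by apply/val_inj; rewrite /= -(split_part_one fQ mf) eq_fg split_part_one.
  rewrite -{p}eq_mp in pg eq_fg *; congr (_, _); apply/ffunP => l; apply/val_inj.
  (* [split_part] overwrites the value at [one], but there [f] and [g] both vanish. *)
  have [->|l1] := eqVneq l one.
    by move: fQ gQ; rewrite !inE => /andP[_ /eqP->] /andP[_ /eqP->].
  by rewrite /= -(split_part_neq fQ mf l1) eq_fg split_part_neq.
apply/subset_leq_card/subsetP => _ /imsetP[[f m] fm ->].
by case/andP: fm => /= fQ mf; apply: split_part_in.
Qed.

(** Markov's inequality for the number of part sizes. *)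
Lemma card_onefree_many k :
  k * #|[set f in onefree | k <= #|part_sizes f|]| <= #|partitions|.
Proof.
apply: leq_trans sum_card_part_sizes; rewrite mulnC -sum_nat_const.
rewrite [leqRHS](bigID (fun f => k <= #|part_sizes f|)) /=.
apply: leq_trans (leq_addr _ _).
rewrite (eq_bigl (fun f => (f \in onefree) && (k <= #|part_sizes f|))); last first.
  by move=> f; rewrite inE.
by apply: leq_sum => f /andP[].
Qed.

(** Such an [f] is determined by a list of [k] pairs (size, multiplicity). *)
Lemma card_few_part_sizes k :
  #|[set f : {ffun 'I_n.+1 -> 'I_n.+1} | #|part_sizes f| <= k]| <= (n.+1 ^ 2) ^ k.
Proof.
pose code f := [ffun i : 'I_k =>
  let l := nth ord0 (enum (part_sizes f)) i in (l, f l)].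
set D := (X in #|X|).
(* Every entry of [code g], including the padding at [ord0], lies on the graph of [g], so [l] need
   not be known to be a size of [g]. *)
have codeP f g l : f \in D -> l \in part_sizes f -> code f = code g -> f l = g l.
  rewrite inE cardE => le_k; rewrite -mem_enum => lf.
  have lt_k : index l (enum (part_sizes f)) < k by rewrite (leq_trans _ le_k) ?index_mem.
  move=> /ffunP/(_ (Ordinal lt_k)).
  by rewrite !ffunE /= nth_index // => -[<- ->].
have code_inj : {in D &, injective code}.
  move=> f g fD gD eq_fg; apply/ffunP => l.
  have [lf|] := boolP (l \in part_sizes f); first exact: codeP eq_fg.
  have [lg|] := boolP (l \in part_sizes g); first by rewrite (codeP g f).
  by rewrite !inE !negbK => /eqP-> /eqP->.
rewrite -(card_in_imset code_inj); apply: leq_trans (max_card _) _.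
by rewrite card_ffun card_prod !card_ord.
Qed.

Lemma card_partitions_ge K M : 0 < K -> 0 < M -> K.+2 ^ 2 * M <= n ->
  M ^ K <= #|partitions|.
Proof.
case: K M => // K [//|M] _ _ le_n.
(* After the case split the free sizes are [2] to [K.+2], which are [K.+1] in number; [inord] is
   exact on this range. *)
pose F (g : {ffun 'I_K.+1 -> 'I_M.+1}) (l : nat) : nat :=
  if 1 < l < K.+3 then val (g (inord (l - 2))) else 0.
have leF (g : {ffun 'I_K.+1 -> 'I_M.+1}) : \sum_(i < n.+1 | i != one) i * F g i <= n.
  have leKn : K.+3 <= n.+1 by apply: leq_trans (leq_trans le_n _) => //; nia.
  apply: leq_trans le_n; rewrite big_mkcond /=.
  (* There are [K.+3] indices, each contributing at most [K.+3 * M.+1]: this is the source of the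
     square in the hypothesis. *)
  apply: (@leq_trans (\sum_(i < n.+1 | i < K.+3) K.+3 * M.+1)).
    rewrite [leqRHS]big_mkcond /=; apply: leq_sum => i _.
    rewrite /F; case: eqP => // _; case: (ltnP i K.+3) => iK; rewrite ?andbF ?muln0 //.
    case: ifP => _; rewrite ?muln0 //.
    by apply: leq_mul; [apply: ltnW | apply/ltnW/ltn_ord].
  by rewrite (big_ord_narrow leKn) sum_nat_const card_ord mulnA.
have F0 (g : {ffun 'I_K.+1 -> 'I_M.+1}) : F g (@ord0 n) = 0 by [].
pose h (g : {ffun 'I_K.+1 -> 'I_M.+1}) := fill_with_ones (F g).
have h_inj : injective h.
  move=> g g' eq_h; apply/ffunP => i; apply/val_inj => /=.
  have lt_in : i.+2 < n.+1.
    by have := ltn_ord i; move: le_n; nia.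
  have i1 : Ordinal lt_in != one.
    by apply/eqP => /(congr1 val); rewrite /= oneE.
  have := congr1 (fun f : {ffun 'I_n.+1 -> 'I_n.+1} => val (f (Ordinal lt_in))) eq_h.
  rewrite /= !fill_with_ones_neq // /F /= !ltnS leq_ord.
  by rewrite subn2 /= inord_val.
rewrite -[X in X ^ _]card_ord -[X in _ ^ X]card_ord -card_ffun.
rewrite -(card_imset _ h_inj).
apply/subset_leq_card/subsetP => _ /imsetP[g _ ->].
exact: fill_with_ones_in.
Qed.

End Partitions.

(** * Scarcity of partitions without part 1 *)

Lemma card_onefree_small k : exists N : nat, forall n, N <= n ->
  k * #|onefree n| <= 2 * #|partitions n|.
Proof.
(* [c] is the constant of [card_partitions_ge] for [K = 2 * k + 1]. With [n + 1 <= 2 * c * M], the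
   bound [k * (n + 1) ^ (2 * k)] is at most [B * M ^ (2 * k)], and the one extra factor [M] absorbs
   [B]. *)
pose c := ((2 * k).+3) ^ 2; pose B := k * (2 * c) ^ (2 * k).
exists (c * B.+1) => n le_n.
have c_gt0 : 0 < c by rewrite expn_gt0.
have n_gt0 : 0 < n by apply: leq_trans le_n; rewrite muln_gt0 c_gt0.
pose M := n %/ c; have leBM : B < M by rewrite leq_divRL // mulnC.
have M_gt0 : 0 < M by apply: leq_trans leBM.
have le_cM : c * M <= n by rewrite mulnC leq_divM.
(* [n < c * (M + 1)], and [M >= 1] absorbs the rounding. *)
have lt_n : n.+1 <= 2 * c * M.
  have := ltn_ceil n c_gt0; rewrite -/M => /leq_trans; apply.
  by rewrite -mulnA mul2n -addnn mulSn mulnC leq_add2r leq_pmulr.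
pose few := [set f in onefree n | #|part_sizes f| <= k].
have card_few : k * #|few| <= #|partitions n|.
  apply: leq_trans (card_partitions_ge n_gt0 (ltn0Sn (2 * k)) M_gt0 le_cM).
  apply: (@leq_trans (k * (n.+1 ^ 2) ^ k)).
    rewrite leq_mul2l; apply/orP; right; apply: leq_trans (card_few_part_sizes n k).
    by apply/subset_leq_card/subsetP => f; rewrite !inE => /andP[].
  rewrite -expnM expnS; apply: (@leq_trans (k * (2 * c * M) ^ (2 * k))).
    by case: (k) => // j; rewrite leq_mul2l leq_exp2r ?lt_n ?orbT.
  by rewrite expnMn mulnA leq_mul2r; apply/orP; right; apply: ltnW.
have le_onefree : #|onefree n| <=
    #|[set f in onefree n | k <= #|part_sizes f|]| + #|few|.
  apply: leq_trans (leq_card_setU _ _); apply/subset_leq_card/subsetP => f fQ.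
  by move: fQ; rewrite !in_set => ->; case: leqP => //= /ltnW.
apply: (@leq_trans (k * (#|[set f in onefree n | k <= #|part_sizes f|]| + #|few|))).
  by rewrite leq_mul2l le_onefree orbT.
by rewrite mulnDr mul2n -addnn leq_add // card_onefree_many.
Qed.

(** * Cycle structures of permutations *)

(** In a larger orbit the duplicate-free [traject] would show [x] at both positions 0 and [k]. *)
Lemma porbit_card_le (T : finType) (s : {perm T}) x k :
  0 < k -> iter k s x = x -> #|porbit s x| <= k.
Proof.
move=> k_gt0 sk; rewrite leqNgt; apply/negP => lt_k.
have c_gt0 : 0 < #|porbit s x| by apply: leq_ltn_trans lt_k.
have := @nth_uniq _ x _ k 0 _ _ (uniq_traject_porbit s x).
rewrite !size_traject !nth_traject //= sk eqxx => /(_ lt_k c_gt0).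
by rewrite eqn0Ngt k_gt0.
Qed.

(** The cycles of length [l] partition the points lying on them into blocks of [l] points. *)
Lemma card_porbit_size n (s : 'S_n) (l : 'I_n.+1) :
  #|[set x | #|porbit s x| == l]| = l * perm_cycle_structure s l.
Proof.
rewrite ffunE -sum1_card.
rewrite (partition_big (porbit s) (mem [set C in porbits s | #|C| == l])) /=; last first.
  by move=> x; rewrite !inE => ->; rewrite andbT; apply: imset_f.
rewrite mulnC -sum_nat_const; apply: eq_bigr => C.
rewrite inE => /andP[/imsetP[y _ ->] /eqP yl].
rewrite sum1_card -[RHS]yl; apply: eq_card => x.
rewrite unfold_in /= inE eq_porbit_mem.
case: (boolP (x \in porbit s y)) => [xy|_]; last by rewrite andbF.
by move: xy; rewrite -eq_porbit_mem => /eqP->; rewrite yl eqxx.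
Qed.

Lemma sum_perm_cycle_structure n (s : 'S_n) :
  \sum_(l < n.+1) l * perm_cycle_structure s l = n.
Proof.
under eq_bigr do rewrite -card_porbit_size -sum1_card.
have lt_size x : #|porbit s x| < n.+1.
  by rewrite ltnS -[X in _ <= X]card_ord max_card.
rewrite -[RHS]card_ord -sum1_card.
rewrite [RHS](partition_big (fun x => inord #|porbit s x| : 'I_n.+1) predT) //=.
apply: eq_bigr => l _; apply: eq_bigl => x.
by rewrite inE -val_eqE /= inordK.
Qed.

Lemma perm_cycle_structure0 n (s : 'S_n) : perm_cycle_structure s ord0 = 0.
Proof.
rewrite ffunE; apply/eqP; rewrite cards_eq0; apply/eqP/setP => C; rewrite !inE.
by apply/negP => /andP[/imsetP[x _ ->]]; apply/negP/card_porbit_neq0.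
Qed.

(** The model is the set of [(l, i, j)], position [j] on the [i]-th cycle of length [l], with [j]
    rotated modulo [l]. It has [n] elements, and an enumeration carries the rotation over to
    ['I_n]. *)
Lemma perm_with_cycle_structure n (f : 'I_n.+1 -> nat) :
  f ord0 = 0 -> \sum_(l < n.+1) l * f l = n ->
  exists s : 'S_n, perm_cycle_structure s =1 f.
Proof.
move=> f0 sum_f.
pose T : finType := {l : 'I_n.+1 & ('I_(f l) * 'I_l)%type}.
have cardT : #|T| = n.
  rewrite card_tagged sumnE big_map big_enum /= -[RHS]sum_f.
  by apply: eq_bigr => l _; rewrite card_prod !card_ord mulnC.
pose tg (l : 'I_n.+1) (u : 'I_(f l) * 'I_l) : T :=
  Tagged (fun l : 'I_n.+1 => 'I_(f l) * 'I_l)%type u.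
pose rot (t : T) : T := tg _
  (let u := tagged t in (u.1, ordS u.2)).
have rotE (l : 'I_n.+1) (i : 'I_(f l)) (j : 'I_l) k :
    exists2 j' : 'I_l, j' = (j + k) %% l :> nat &
    iter k rot (tg l (i, j)) =
      tg l (i, j').
  elim: k => [|k [j' j'E IH]]; first by exists j; rewrite // addn0 modn_small.
  exists (ordS j'); last by rewrite iterS IH.
  by rewrite /= j'E -addn1 modnDml addn1 addnS.
have tg_inj l : injective (@tg l).
  by move=> u v /eqP; rewrite -tag_eqE /tag_eq /= eqxx tagged_asE => /eqP.
have rot_inj : injective rot.
  move=> [l [i j]] [l' [i' j']] eq_r.
  have ll' : l = l' by have := congr1 tag eq_r.
  case: l' / ll' i' j' eq_r => i' j' /tg_inj[-> eq_j].
  have /ordS_inj-> // : ordS j = ordS j' by apply: val_inj.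
pose e (t : T) : 'I_n := cast_ord cardT (enum_rank t).
pose d (x : 'I_n) : T := enum_val (cast_ord (esym cardT) x).
have eK : cancel e d by move=> t; rewrite /d /e cast_ordK enum_rankK.
have dK : cancel d e by move=> x; rewrite /d /e enum_valK cast_ordKV.
have s_inj : injective (e \o rot \o d).
  exact: inj_comp (inj_comp (can_inj eK) rot_inj) (can_inj dK).
pose s := perm s_inj; exists s.
have sE k t : iter k s (e t) = e (iter k rot t).
  by elim: k => //= k ->; rewrite permE /= eK.
have size_s (l : 'I_n.+1) (i : 'I_(f l)) (j : 'I_l) :
    #|porbit s (e (tg l (i, j)))| = l.
  have l_gt0 : 0 < l by apply: leq_ltn_trans (ltn_ord j).
  apply/eqP; rewrite eqn_leq; apply/andP; split.
    apply: porbit_card_le => //; rewrite sE; congr e.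
    have [j' j'E ->] := rotE l i j l; congr (tg _ (_, _)).
    by apply/val_inj; rewrite /= j'E modnDr modn_small.
  (* The orbit size [c] is a return time, so [j + c] equals [j] modulo [l] and [l] divides [c]. *)
  apply: dvdn_leq; first by rewrite lt0n card_porbit_neq0.
  set c := #|_|; have := iter_porbit s (e (tg l (i, j))).
  rewrite -/c sE => /(can_inj eK); have [j' j'E ->] := rotE l i j c.
  move=> /tg_inj[eq_j]; move: j'E; rewrite eq_j => /esym/eqP.
  by rewrite -[X in _ == X](modn_small (ltn_ord j)) -[X in _ == X %% _]addn0 eqn_modDl mod0n.
(* For [l > 0] the factor [l] can be cancelled, so counting points on cycles of length [l] replaces
   counting cycles. *)
move=> l; case: (posnP l) => [l0|l_gt0].
  have -> : l = ord0 by apply: val_inj.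
  by rewrite perm_cycle_structure0 f0.
apply/eqP; rewrite -(eqn_pmul2l l_gt0) -card_porbit_size; apply/eqP.
transitivity #|[set (e \o @tg l) u | u in [set: 'I_(f l) * 'I_l]]|.
  apply: eq_card => x; rewrite inE -[x]dK; case: (d x) => l' [i j].
  rewrite size_s; apply/eqP/imsetP => [ll'|[u _ /(can_inj eK)]].
    have {}ll' : l' = l by apply: val_inj.
    by case: l / ll' l_gt0; exists (i, j).
  by move/(congr1 tag) => /= ->.
rewrite card_imset; last by apply: inj_comp (can_inj eK) (@tg_inj l).
by rewrite cardsT card_prod !card_ord mulnC.
Qed.

(** * Autotopisms from fixed points *)

Lemma fixed_point_autotopism n (Theta : isotopism n) (t : triple n) :
  isotopism_act Theta t = t ->
  exists P : array n,
    [&& partial_latin_square P, nonempty_array P & autotopism Theta P].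
Proof.
case: t => [[r c] x] fix_t.
pose P : array n := (\matrix_(i, j) if (i == r) && (j == c) then Some x else None)%R.
have PE i j y : (P i j == Some y) = ((i, j, y) == (r, c, x)).
  rewrite mxE !xpair_eqE; case: ifP => _ //=.
  by rewrite -[Some x == Some y]/(x == y) eq_sym.
have entriesP : entries P = [set (r, c, x)].
  by apply/setP => -[[i j] y]; rewrite !inE PE.
exists P; apply/and3P; split.
- apply/forallP => y; apply/andP; split; apply/forallP => i.
    rewrite -(cards1 c) subset_leq_card //; apply/subsetP => j.
    by rewrite !inE PE !xpair_eqE => /andP[/andP[]].
  rewrite -(cards1 r) subset_leq_card //; apply/subsetP => j.
  by rewrite !inE PE !xpair_eqE => /andP[/andP[]].
- by apply/existsP; exists r; apply/existsP; exists c; rewrite mxE !eqxx.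
- by rewrite /autotopism entriesP imset_set1 fix_t.
Qed.

Lemma perm_cycle_structure_fixed_point n (s : 'S_n) (l : 'I_n.+1) : l = 1 :> nat ->
  perm_cycle_structure s l != 0 -> exists x, s x = x.
Proof.
move=> l1; rewrite ffunE cards_eq0 => /set0Pn[C]; rewrite inE l1.
case/andP => /imsetP[x _ ->] /eqP x1; exists x.
by have := iter_porbit s x; rewrite x1.
Qed.

(** * Cycle structures as triples of partitions *)

Section CycleStructures.
Variable n : nat.
Local Notation parts := {ffun 'I_n.+1 -> 'I_n.+1}.

(** Bridge from the bounded multiplicities, which form a finite type, to the [nat]-valued cycle
    structures. *)
Definition natval (f : parts) : {ffun 'I_n.+1 -> nat} := [ffun l => val (f l)].

Lemma natval_inj : injective natval.
Proof.
move=> f g /ffunP eq_fg; apply/ffunP => l; apply/val_inj.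
by have := eq_fg l; rewrite !ffunE.
Qed.

Lemma partition_of_perm (s : 'S_n) :
  exists2 f, f \in partitions n & perm_cycle_structure s = natval f.
Proof.
have le_n (l : 'I_n.+1) : perm_cycle_structure s l <= n.
  case: (posnP l) => [l0|l_gt0].
    by rewrite (_ : l = ord0) ?perm_cycle_structure0 //; apply: val_inj.
  rewrite -[leqRHS](sum_perm_cycle_structure s) (bigD1 l) //=.
  by apply: leq_trans (leq_addr _ _); rewrite leq_pmull.
pose f : parts := [ffun l => inord (perm_cycle_structure s l)].
have fE l : f l = perm_cycle_structure s l :> nat by rewrite ffunE inordK ?ltnS.
exists f; last by apply/ffunP => l; rewrite [RHS]ffunE /= fE.
rewrite inE -val_eqE /= fE perm_cycle_structure0 eqxx /=.
by under eq_bigr do rewrite fE; rewrite sum_perm_cycle_structure.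
Qed.

Lemma perm_of_partition f : f \in partitions n ->
  exists s : 'S_n, perm_cycle_structure s = natval f.
Proof.
rewrite inE => /andP[/eqP f0 /eqP sum_f].
have [|s sE] := @perm_with_cycle_structure n (val \o f) _ sum_f; first by rewrite /= f0.
by exists s; apply/ffunP => l; rewrite sE ffunE.
Qed.

Definition triples (A : {set parts}) : {set parts * parts * parts} :=
  setX (setX A A) A.

Definition natval3 (t : parts * parts * parts) :=
  (natval t.1.1, natval t.1.2, natval t.2).

Lemma natval3_inj : injective natval3.
Proof. by move=> [[f g] h] [[f' g'] h'] [/natval_inj-> /natval_inj-> /natval_inj->]. Qed.

Lemma card_natval3 (A : {set parts}) :
  #|` [fset natval3 t | t in triples A]%fset| = #|A| ^ 3.
Proof.
rewrite card_imfset; last exact: natval3_inj.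
by rewrite -cardE !cardsX -mulnA.
Qed.

Lemma CS_isotopismsE :
  CS_isotopisms n = [fset natval3 t | t in triples (partitions n)]%fset.
Proof.
apply/fsetP => x; apply/imfsetP/imfsetP => /= -[].
  move=> [[a b] c] _ ->.
  have [f fP fE] := partition_of_perm a.
  have [g gP gE] := partition_of_perm b.
  have [h hP hE] := partition_of_perm c.
  by exists (f, g, h); rewrite ?in_setX /= ?fP ?gP //= /natval3 /= fE gE hE.
move=> [[f g] h]; rewrite !in_setX /= => /andP[/andP[fP gP] hP] ->.
have [a aE] := perm_of_partition fP.
have [b bE] := perm_of_partition gP.
have [c cE] := perm_of_partition hP.
by exists (a, b, c); rewrite ?inE //= aE bE cE.
Qed.

Lemma CS_autotopisms_sub : (CS_autotopisms n `<=` CS_isotopisms n)%fset.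
Proof.
apply/fsubsetP => _ /imfsetP[/= Theta _ ->].
by apply/imfsetP; exists Theta; rewrite ?inE.
Qed.

Lemma sub_CS_autotopisms : 0 < n ->
  ([fset natval3 t | t in triples (partitions n :\: onefree n)]
     `<=` CS_autotopisms n)%fset.
Proof.
move=> n_gt0; apply/fsubsetP => _ /imfsetP[/= [[f g] h] + ->].
rewrite !in_setX /= => /andP[/andP[fP gP] hP].
have perm_fix k : k \in partitions n :\: onefree n ->
    exists2 s : 'S_n, perm_cycle_structure s = natval k & exists x, s x = x.
  rewrite in_setD andbC [_ \in onefree n]inE => /andP[kP]; rewrite kP /= => k1.
  have [s sE] := perm_of_partition kP; exists s => //.
  by apply: (perm_cycle_structure_fixed_point (oneE n_gt0)); rewrite sE ffunE.
have [a aE [i ai]] := perm_fix f fP.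
have [b bE [j bj]] := perm_fix g gP.
have [c cE [x cx]] := perm_fix h hP.
apply/imfsetP; exists (a, b, c); last by rewrite /= aE bE cE.
rewrite inE; apply/existsP; apply: (@fixed_point_autotopism _ _ (i, j, x)).
by rewrite /= ai bj cx.
Qed.

Lemma card_CS_isotopisms : #|` CS_isotopisms n| = #|partitions n| ^ 3.
Proof. by rewrite CS_isotopismsE card_natval3. Qed.

Lemma card_CS_autotopisms_le : #|` CS_autotopisms n| <= #|` CS_isotopisms n|.
Proof. exact/fsubset_leq_card/CS_autotopisms_sub. Qed.

Lemma card_CS_autotopisms_ge : 0 < n ->
  (#|partitions n| - #|onefree n|) ^ 3 <= #|` CS_autotopisms n|.
Proof.
move=> n_gt0; have := fsubset_leq_card (sub_CS_autotopisms n_gt0).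
rewrite card_natval3 cardsD (setIidPr _) //.
by apply/subsetP => f; rewrite inE => /andP[].
Qed.

End CycleStructures.

(** * Passage to the limit *)

Lemma CS_isotopisms_gt0 n : 0 < #|` CS_isotopisms n|.
Proof.
rewrite cardfs_gt0; apply/fset0Pn; exists (cycle_structure (1, 1, 1)%g).
by apply/imfsetP; exists (1, 1, 1)%g; rewrite ?inE.
Qed.

(** This is [1 - ratio <= 6 / k] without division. The 6 comes from [1 - (1 - x) ^ 3 <= 3 * x] with
    [x <= 2 / k] the proportion of partitions without part 1. *)
Lemma CS_autotopisms_asymptotic k : exists N : nat, forall n, N <= n ->
  k * #|` CS_isotopisms n| <= k * #|` CS_autotopisms n| + 6 * #|` CS_isotopisms n|.
Proof.
have [N le_kN] := card_onefree_small k; exists N.+1 => n lt_Nn.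
have n_gt0 : 0 < n by apply: leq_trans lt_Nn.
have := card_CS_autotopisms_ge n_gt0; have := le_kN n (ltnW lt_Nn).
have := subset_leq_card (_ : onefree n \subset partitions n).
rewrite card_CS_isotopisms; move: #|onefree n| #|partitions n| #|` _| => q p c.
move=> le_qp le_kq le_c; have {}le_qp : q <= p.
  by apply: le_qp; apply/subsetP => f; rewrite inE => /andP[].
move: (p - q) le_c (subnK le_qp) => a le_c defp.
(* With [p = a + q], the difference of cubes is [q * (p ^ 2 + p * a + a ^ 2)]. *)
have le_p3 : p ^ 3 <= a ^ 3 + 3 * q * p ^ 2 by rewrite -defp; nia.
apply: (@leq_trans (k * (c + 3 * q * p ^ 2))).
  by rewrite leq_mul2l (leq_trans le_p3) ?orbT // leq_add2r.
rewrite mulnDr leq_add2l.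
have -> : k * (3 * q * p ^ 2) = (k * q) * (3 * p ^ 2) by nia.
apply: leq_trans (_ : 2 * p * (3 * p ^ 2) <= _); last by nia.
by rewrite leq_mul2r le_kq orbT.
Qed.

From mathcomp Require Import all_classical all_reals all_analysis.

Import Order.TTheory GRing.Theory Num.Theory.
Import numFieldNormedType.Exports.
Local Open Scope classical_set_scope.
Local Open Scope ring_scope.

Lemma cvg_nat_ratio (R : realType) (a b : nat -> nat) :
  (forall n, (a n <= b n)%N) -> (forall n, (0 < b n)%N) ->
  (forall k, exists N, forall n, (N <= n)%N -> (k * b n <= k * a n + 6 * b n)%N) ->
  (fun n => (a n)%:R / (b n)%:R : R) @ \oo --> (1 : R).
Proof.
move=> le_ab b_gt0 small; apply/cvgrPdist_lt => e e_gt0.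
(* Chosen so that the error [6 / k] is below [e]. *)
pose k := (Num.trunc (6 / e)).+1; have [N le_k] := small k.
exists N => // n /= le_Nn; have := le_k n le_Nn.
rewrite -(ler_nat R) natrD !natrM => le_kb.
have b_gt0R : 0 < (b n)%:R :> R by rewrite ltr0n.
have le_abR : (a n)%:R <= (b n)%:R :> R by rewrite ler_nat.
have lt_k : 6 < k%:R * e by rewrite -ltr_pdivrMr // truncnS_gt.
have -> : 1 - (a n)%:R / (b n)%:R = ((b n)%:R - (a n)%:R) / (b n)%:R :> R.
  by rewrite mulrBl divff ?gt_eqF.
rewrite ger0_norm; last first.
  by rewrite divr_ge0 ?subr_ge0.
rewrite ltr_pdivrMr // -(ltr_pM2l (_ : 0 < k%:R)) ?ltr0n //.
(* [k * (b n - a n) <= 6 * b n < k * e * b n], the last step being [lt_k] multiplied by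
   [b n > 0]. *)
nra.
Qed.

Theorem theorem6 (R : realType) :
  (fun n : nat => (#|` CS_autotopisms n|%fset)%:R / (#|` CS_isotopisms n|%fset)%:R : R)
    @ \oo --> (1 : R).
Proof.
apply: cvg_nat_ratio; first exact: card_CS_autotopisms_le.
  exact: CS_isotopisms_gt0.
exact: CS_autotopisms_asymptotic.
Qed.
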